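(* Let $X$ be a paracompact Čech-complete (completely regular Hausdorff) space, and let $\varepsilon>0$. Then there is an usco mapping $\varphi:\mathscr{P}(X)\to\mathscr{C}(X)$ such that $\mu(X\setminus\varphi(\mu))<\varepsilon$ for every $\mu\in\mathscr{P}(X)$. In particular, $\Phi(T)=\bigcup\{\varphi(\mu):\mu\in T\}$, $T\in\mathscr{C}(\mathscr{P}(X))$, defines a continuous map $\Phi:\big(\mathscr{C}(\mathscr{P}(X)),\tau_V^+\big)\to\big(\mathscr{C}(X),\tau_V^+\big)$ such that $\mu(X\setminus\Phi(T))<\varepsilon$ for every $T\in\mathscr{C}(\mathscr{P}(X))$ and every $\mu\in T$.
   Context: All spaces are assumed to be completely regular and Hausdorff. For a space $X$, $\mathscr{B}(X)$ is the Borel $\sigma$-algebra of $X$. A Radon measure on $X$ is a countably additive function $\mu:\mathscr{B}(X)\to[0,+\infty]$ such that $\mu(B)=\sup\{\mu(K):K\subset B \text{ and } K \text{ is compact}\}$ for every $B\in\mathscr{B}(X)$; it is a Radon probability measure if in addition $\mu(X)=1$. $\mathscr{P}(X)$ denotes the set of all Radon probability measures on $X$, endowed with the weakest topology for which all functionals $\mu\mapsto\int g\,d\mu$, with $g:X\to\mathbb{R}$ bounded and continuous, are continuous. For a space $Y$, $2^Y$ is the family of all nonempty subsets of $Y$, and $\mathscr{C}(Y)$ is the family of all nonempty compact subsets of $Y$. The upper Vietoris topology $\tau_V^+$ on $\mathscr{C}(Y)$ is the topology generated by the sets $\langle V\rangle=\{S\in\mathscr{C}(Y):S\subset V \text{ and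 } S\cap V\neq\varnothing\}=\{S\in\mathscr{C}(Y):S\subset V\}$, where $V$ runs over the open subsets of $Y$. A set-valued mapping $\psi:Z\to 2^Y$ is upper semi-continuous (u.s.c.) if $\{z\in Z:\psi(z)\subset U\}$ is open in $Z$ for every open $U\subset Y$; it is usco if it is u.s.c. and all its values are compact. *)

(* Defs.v *)
From HB Require Import structures.
From mathcomp Require Import all_boot all_order all_algebra.
From mathcomp Require Import all_classical all_reals all_analysis borel_hierarchy.
Import Order.TTheory GRing.Theory Num.Theory.
Import numFieldNormedType.Exports.

Set Implicit Arguments.
Unset Strict Implicit.
Unset Printing Implicit Defensive.

Local Open Scope classical_set_scope.
Local Open Scope ring_scope.

Definition open_cover (X : topologicalType) (C : set (set X)) :=
  C `<=` open /\ \bigcup_(U in C) U = [set: X].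

Definition locally_finite (X : topologicalType) (C : set (set X)) :=
  forall x : X, exists2 N, nbhs x N & finite_set [set V | C V /\ V `&` N !=set0].

Definition refines (X : Type) (D C : set (set X)) :=
  forall V, D V -> exists2 U, C U & V `<=` U.

Definition paracompact (X : topologicalType) :=
  forall C : set (set X), open_cover C ->
  exists D : set (set X), [/\ open_cover D, locally_finite D & refines D C].

Definition embedding (X Y : topologicalType) (c : X -> Y) :=
  injective c /\ @open X = [set c @^-1` V | V in @open Y].

Definition compactification (X K : topologicalType) (c : X -> K) :=
  [/\ compact [set: K], hausdorff_space K, embedding c & dense (range c)].

(* A space is Cech-complete if it is a G_delta in some compactification
   (equivalently, in every compactification, or in its Stone-Cech
   compactification). *)
Definition cech_complete (X : topologicalType) :=
  exists (K : topologicalType) (c : X -> K),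
    compactification c /\ Gdelta (range c).

Record compacts (Y : topologicalType) := Compacts {
  compacts_set :> set Y;
  compacts_nonempty : compacts_set !=set0;
  compacts_compact : compact compacts_set }.

(* Upper Vietoris topology; as the members of [compacts Y] are nonempty, the
   condition that S meets V is implied by S `<=` V. *)
Section upper_vietoris.
Variable Y : topologicalType.

HB.instance Definition _ := gen_eqMixin (compacts Y).
HB.instance Definition _ := gen_choiceMixin (compacts Y).
HB.instance Definition _ := @isSubBaseTopological.Build (compacts Y)
  (set Y) (@open Y) (fun V => [set S : compacts Y | S `<=` V]).

End upper_vietoris.

Definition usc (Z Y : topologicalType) (psi : Z -> set Y) :=
  forall U : set Y, open U -> open [set z | psi z `<=` U].

Definition usco (Z Y : topologicalType) (psi : Z -> set Y) :=
  [/\ forall z, psi z !=set0, forall z, compact (psi z) & usc psi].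

(* A [measurableType] carries a distinguished point, whereas a space may be
   empty. The Borel measurable space of X is therefore built from a point x;
   its sigma-algebra, its measures and their integrals do not depend on x. *)
Definition pointed_at (T : choiceType) (x : T) : pointedType :=
  HB.pack (Choice.sort T) (isPointed.Build T x).

Notation borel_space x :=
  (@g_sigma_algebraType (pointed_at x) (@open _)).

Definition radon (R : realType) (X : topologicalType) (mu : set X -> \bar R) :=
  forall B : set X, <<s @open X >> B ->
  mu B = ereal_sup [set mu K | K in [set K | K `<=` B /\ compact K]].

(* The last clause gives the junk value 0 to the sets that are not Borel, so
   that measures which agree on the Borel sets are equal. *)
Definition radon_probability (R : realType) (X : topologicalType)
    (mu : set X -> \bar R) :=
  [/\ exists (x : X) (P : probability (borel_space x) R),
        mu = (P : set X -> \bar R),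
      radon mu &
      forall A, ~ <<s @open X >> A -> mu A = 0%E].

Record radon_prob (R : realType) (X : topologicalType) := RadonProb {
  radon_prob_measure :> set X -> \bar R;
  radon_probP : radon_probability radon_prob_measure }.

Definition bounded_continuous (R : realType) (X : topologicalType) :=
  {g : X -> R | continuous g /\ bounded_fun g}.

Definition borel_integral (R : realType) (X : topologicalType) (x : X)
    (g : X -> R) (mu : radon_prob R X) : R :=
  fine (\int[(mu : set (borel_space x) -> \bar R)]_(y in [set: borel_space x])
    (g y)%:E)%E.

Section weak_topology.
Variables (R : realType) (X : topologicalType).

HB.instance Definition _ := gen_eqMixin (radon_prob R X).
HB.instance Definition _ := gen_choiceMixin (radon_prob R X).
HB.instance Definition _ := Topological.copy (radon_prob R X)
  (sup_topology (fun i : X * bounded_continuous R X =>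
    Topological.on (initial_topology
      (borel_integral i.1 (sval i.2) : radon_prob R X -> R)))).

End weak_topology.

(* Main.v *)
From HB Require Import structures.
Require Import Defs.
From mathcomp Require Import all_boot all_order all_algebra finmap lra.
From mathcomp Require Import all_classical all_reals all_analysis.
From mathcomp Require Import measurable_realfun.
Import Order.TTheory GRing.Theory Num.Theory.
Import numFieldNormedType.Exports.

Set Implicit Arguments.
Unset Strict Implicit.
Unset Printing Implicit Defensive.

Local Open Scope classical_set_scope.
Local Open Scope ring_scope.

(** A Cech-complete space has a sequence of open covers C_n such that a filter
    containing, for each n, a set covered by finitely many closures of members
    of C_n always has a cluster point: take for C_n the open sets whose closure
    in the compactification stays inside the n-th open set G_n of the G_delta
    representation ([cech_complete_covers]).  Consequently, if the F_n(z) are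
    closed, finitely covered by C_n in this sense, and F_n(z') is included in
    F_n(z) for z' near z, then z |-> \bigcap_n F_n(z) is upper semi-continuous
    with compact values ([usco_bigcap]).  It therefore suffices to find, for
    each open cover C and each e > 0, such a selection F with
    mu(X \ F(mu)) <= e ([tight_selection]), and to use it for C_n with
    e / 2^(n+1), where e is less than both eps and 1; the bound e < 1 makes the
    intersections non-empty.

    To build F, paracompactness gives a partition of unity (p_i) subordinate
    to C.  The masses a_i(mu) = \int p_i dmu depend continuously on mu, are
    non-negative, and sum to 1 because mu is carried up to arbitrarily small
    mass by compact sets, on each of which a finite subfamily of the p_i
    already sums to 1.  One has to select, upper semi-continuously, finitely
    many indices carrying all but e of the mass.  Any threshold on a_i alone
    would have to depend on mu; instead an index i is declared heavy at mu when
    the indices of strictly larger mass carry at most 1 - e altogether.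
    Being light is witnessed by finitely many strict inequalities between
    continuous functions, hence is an open condition, and the light indices
    carry less than e, as one sees by looking at the light index of largest
    mass ([heavy_selection]).  F(mu) is the union of the closed supports of the
    p_i over the heavy i.

    Finally an u.s.c. map with compact values sends compact sets to compact
    sets ([usc_compact_bigcup]), and the induced map on compact sets is
    continuous for the upper Vietoris topologies because the preimage of a
    subbasic open set is again subbasic. *)

(** * Finite sums *)

Section finite_sums.
Variable R : realType.

Lemma le_sum_fset (I : choiceType) (A B : {fset I}) (a : I -> R) :
  (forall i, 0 <= a i) -> (A `<=` B)%fset ->
  \sum_(i <- A) a i <= \sum_(i <- B) a i.
Proof.
move=> a0 /fsubsetP AB.
rewrite (big_fsetID _ (mem A) B) /= (_ : [fset x in B | x \in A]%fset = A).
  by rewrite lerDl sumr_ge0.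
apply/fsetP => i; rewrite !inE /=.
by have [/AB ->|] := boolP (i \in A); rewrite ?andbF.
Qed.

Lemma sum_fsetU_disjoint (I : choiceType) (A B : {fset I}) (a : I -> R) :
  [disjoint A & B]%fset ->
  \sum_(i <- (A `|` B)%fset) a i =
  \sum_(i <- A) a i + \sum_(i <- B) a i.
Proof.
move=> /fdisjointP dAB; rewrite (big_fsetID _ (mem A)) /=.
congr (_ + _); apply: eq_fbigl => i; rewrite !inE /=.
  by rewrite andb_orl andbb; case: (i \in A); rewrite ?andbF.
have [/dAB/negPf ->|] //= := boolP (i \in A).
by rewrite andbT.
Qed.

Lemma continuous_sum (X : topologicalType) (I : Type) (J : seq I)
    (p : I -> X -> R) :
  (forall i, continuous (p i)) -> continuous (fun y => \sum_(i <- J) p i y).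
Proof. by move=> cp; apply: continuous_big => //; exact: add_continuous. Qed.

End finite_sums.

(** * Paracompact spaces *)

Section paracompact_normal.
Variable X : topologicalType.
Implicit Types (C D E : set (set X)) (U V : set X).

Lemma open_cover_mem C x : open_cover C -> exists2 U, C U & U x.
Proof.
move=> [_ CT]; have [U CU Ux] : (\bigcup_(U in C) U) x by rewrite CT.
by exists U.
Qed.

(** A neighbourhood of x meets only finitely many members of E, and finite
    unions commute with closures. *)
Lemma closure_locally_finite D E : locally_finite D -> E `<=` D ->
  closure (\bigcup_(V in E) V) `<=` \bigcup_(V in E) closure V.
Proof.
move=> lfD ED x clx; have [N Nx finN] := lfD x.
pose EN := [set V | E V /\ V `&` N !=set0].
have finEN : finite_set EN.
  by apply: sub_finite_set finN => V [/ED].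
have clEN : closed (\bigcup_(V in EN) closure V).
  by apply: closed_bigcup => // V _; exact: closed_closure.
suff [V [EV _] clV] : (\bigcup_(V in EN) closure V) x by exists V.
apply: contrapT => nx.
have nb : nbhs x (N `&` ~` (\bigcup_(V in EN) closure V)).
  apply: filterI => //; apply: open_nbhs_nbhs; split => //.
  exact: closed_openC.
have [y [[V EV Vy] [Ny ny]]] := clx _ nb.
by apply: ny; exists V; [split=> //; exists y|exact: subset_closure].
Qed.

Hypotheses (regX : regular_space X) (pX : paracompact X).

(** By regularity the open sets whose closure lies in a member of C still cover
    X; a locally finite refinement of that cover is as required. *)
Lemma paracompact_shrink C : open_cover C -> exists D,
  [/\ open_cover D, locally_finite D &
      forall V, D V -> exists2 U, C U & closure V `<=` U].
Proof.
move=> ocC; pose C' := [set V | open V /\ exists2 U, C U & closure V `<=` U].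
have ocC' : open_cover C'.
  split; first by move=> V [].
  apply/seteqP; split=> // x _; have [U CU Ux] := open_cover_mem x ocC.
  have [V Vx VU] : filter_from (nbhs x) closure U.
    by apply: regX; apply: open_nbhs_nbhs; split => //; apply: (proj1 ocC).
  exists V°; last exact: Vx.
  split; [exact: open_interior|exists U => //].
  by apply: subset_trans VU; apply: closureS; exact: interior_subset.
have [D [ocD lfD DC']] := pX ocC'; exists D; split=> // V DV.
have [W [_ [U CU WU]] VW] := DC' _ DV; exists U => //.
exact: subset_trans (closureS VW) WU.
Qed.

(** Shrink the two-element cover made of the complement of A and of an open set
    G between A and B.  The members of the shrinking that meet A have their
    closure in G, and by local finiteness so does their union. *)
Lemma paracompact_normal : normal_space X.
Proof.
move=> A clA B /set_nbhsP[G [oG AG GB]].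
have [|D [ocD lfD DC]] := @paracompact_shrink [set G; ~` A].
  split; first by move=> U [] -> //; exact: closed_openC.
  apply/seteqP; split=> // x _; have [Ax|nAx] := pselect (A x).
    by exists G; [left|exact: AG].
  by exists (~` A); [right|].
pose E := [set V | D V /\ V `&` A !=set0].
exists (\bigcup_(V in E) V); last first.
  apply: subset_trans GB; apply: subset_trans (closure_locally_finite lfD _) _.
    by move=> V [].
  move=> x [V [DV [a [Va Aa]]] clVx]; have [U [->|->] VU] := DC _ DV.
    exact: VU.
  by have := VU _ (subset_closure Va).
apply/set_nbhsP; exists (\bigcup_(V in E) V); split=> //.
  by apply: bigcup_open => V [/(proj1 ocD)].
move=> a Aa; have [V DV Va] := open_cover_mem a ocD.
by exists V => //; split=> //; exists a.
Qed.

End paracompact_normal.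

Section partition.
Variables (R : realType) (X : topologicalType).

(** Continuity of the finite sums that equal 1 near each point, together with
    the bound on all finite sums, encodes local finiteness: near x every p_i
    with i outside J vanishes. *)
Definition partition_of_unity (I : choiceType) (p : I -> X -> R) :=
  [/\ forall i, continuous (p i), forall i x, 0 <= p i x,
      forall (J : {fset I}) x, \sum_(i <- J) p i x <= 1 &
      forall x : X,
      exists J : {fset I}, \forall y \near x, \sum_(i <- J) p i y = 1].

(** The functions are indexed by the sets themselves, with p_V = 0 for V outside
    a locally finite refinement D of C.  For V in D let W(V) be the union of the
    members of a shrinking of D whose closure lies in V; Urysohn functions that
    are 1 on W(V) and 0 off V have a locally finite sum, which is positive since
    the sets W(V) cover X, and it remains to divide by this sum. *)
Lemma paracompact_partition_of_unity (C : set (set X)) :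
  regular_space X -> paracompact X -> open_cover C ->
  exists p : set X -> X -> R, partition_of_unity p /\
    forall V x, p V x != 0 -> exists2 U, C U & [set y | p V y != 0] `<=` U.
Proof.
move=> regX pX ocC.
have [D [ocD lfD DC]] := pX C ocC.
have [E [ocE lfE ED]] := paracompact_shrink regX pX ocD.
have normX := paracompact_normal regX pX.
pose W V := \bigcup_(V' in [set V' | E V' /\ closure V' `<=` V]) V'.
have WV V : closure (W V) `<=` V.
  apply: subset_trans (closure_locally_finite lfE _) _; first by move=> V' [].
  by move=> x [V' [_]]; exact.
have /choice[h hP] V : exists h : X -> R, [/\ continuous h,
    forall x, 0 <= h x, forall x, h x != 0 -> D V /\ V x &
    forall x, D V -> W V x -> h x = 1].
  have [DV|nDV] := pselect (D V); last first.
    exists (fun=> 0); split=> //; first by move=> x; exact: cvg_cst.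
    by move=> x; rewrite eqxx.
  have oV : open V by apply: (proj1 ocD).
  have [] := @urysohn_ext_itv X R normX (~` V) (closure (W V)) 0 1 => //.
  - exact: open_closedC.
  - exact: closed_closure.
  - by apply/disjoints_subset => x nVx /WV.
  move=> h [ch h0 h1 h01]; exists h; split=> //.
  - by move=> x; have /h01 : range h (h x) by []; rewrite /= in_itv/= => /andP[].
  - move=> x hx; split=> //; apply: contrapT => nVx.
    by move: hx; rewrite (h0 (h x)) ?eqxx//; exists x.
  - by move=> x _ Wx; apply: (h1 (h x)); exists x => //; exact: subset_closure.
have ch V : continuous (h V) by have [] := hP V.
have h_ge0 V x : 0 <= h V x by have [] := hP V.
have /choice[J JP] (x : X) : exists J : {fset set X}, \forall y \near x,
    forall V, h V y != 0 -> V \in J.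
  have [N Nx finN] := lfD x; exists (fset_set [set V | D V /\ V `&` N !=set0]).
  near=> y => V; have [_ _ /(_ y) hV _] := hP V.
  move=> /hV [DV Vy]; rewrite in_fset_set//; apply/mem_set.
  by split=> //; exists y; split=> //; near: y.
pose tot y := \sum_(V <- J y) h V y.
(* Any finite set containing all the indices active at y may serve to compute
   [tot y]; this is what allows a fixed index set near each point. *)
have totE (K : {fset set X}) y : (forall V, h V y != 0 -> V \in K) ->
    tot y = \sum_(V <- K) h V y.
  move=> hK; have hJ := nbhs_singleton (JP y).
  rewrite /tot (big_fset_incl _ (fsubsetUl (J y) K)).
    rewrite [RHS](big_fset_incl _ (fsubsetUr (J y) K))// => V _ nK.
    by apply: contraNeq nK; exact: hK.
  by move=> V _ nJ; apply: contraNeq nJ; exact: hJ.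
have tot_near (x : X) : \forall y \near x, tot y = \sum_(V <- J x) h V y.
  by near=> y; apply: totE; near: y; exact: JP.
have ctot : continuous tot.
  move=> x; rewrite /continuous_at.
  apply: (@cvg_trans _ ((fun y => \sum_(V <- J x) h V y) @ x)).
    by apply: near_eq_cvg; near do apply/esym; exact: tot_near.
  exact: continuous_sum.
have le_tot (K : {fset set X}) y : \sum_(V <- K) h V y <= tot y.
  rewrite (totE (J y `|` K)%fset); last first.
    by move=> V /(nbhs_singleton (JP y)); rewrite inE => ->.
  by apply: le_sum_fset => //; exact: fsubsetUr.
have tot_gt0 y : 0 < tot y.
  have [V' EV' V'y] := open_cover_mem y ocE; have [V DV V'V] := ED _ EV'.
  have [_ _ _ /(_ y DV) hVy] := hP V.
  apply: lt_le_trans (le_tot [fset V]%fset y); rewrite big_seq_fset1 hVy//.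
  by exists V'.
exists (fun V y => h V y / tot y); split; last first.
  move=> V x; rewrite mulf_eq0 negb_or => /andP[hVx _].
  have [_ _ hV _] := hP V; have [DV _] := hV _ hVx.
  have [U CU VU] := DC _ DV; exists U => // y /=.
  by rewrite mulf_eq0 negb_or => /andP[/hV[_ /VU]].
split.
- move=> V x; apply: cvgM; first exact: ch.
  by apply: cvgV; [exact: lt0r_neq0|exact: ctot].
- by move=> V x; rewrite divr_ge0// ltW.
- by move=> K x; rewrite -mulr_suml ler_pdivrMr// mul1r.
- move=> x; exists (J x); near=> y.
  rewrite -mulr_suml -(near (tot_near x) y)// divff//; exact: lt0r_neq0.
Unshelve. all: by end_near. Qed.

End partition.

(** * Selecting the heavy indices *)

Section heavy_indices.
Variables (R : realType) (T : topologicalType) (I : choiceType).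
Variables (a : I -> T -> R) (e : R).
Hypotheses (e_gt0 : 0 < e) (ca : forall i, continuous (a i)).
Hypotheses (a_ge0 : forall i t, 0 <= a i t).
Hypothesis a_le1 : forall (J : {fset I}) t, \sum_(i <- J) a i t <= 1.
Hypothesis a_sum1 : forall t (d : R), 0 < d ->
  exists J : {fset I}, 1 - d < \sum_(i <- J) a i t.

(** Masses are compared with one another and not with a threshold: this is what
    makes the selection upper semi-continuous in t.  Testing finite sets J only
    makes the negation an open condition. *)
Definition heavy t := [set i | forall J : {fset I},
  (forall j, j \in J -> a i t < a j t) -> \sum_(j <- J) a j t <= 1 - e].

Lemma lightP t i : ~ heavy t i -> exists J : {fset I},
  (forall j, j \in J -> a i t < a j t) /\ 1 - e < \sum_(j <- J) a j t.
Proof.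
by move=> /existsNP[J /not_implyP[aJ /negP]]; rewrite -ltNge => eJ; exists J.
Qed.

Lemma near_fset (J : {fset I}) (t : T) (P : I -> T -> Prop) :
  (forall j, j \in J -> \forall t' \near t, P j t') ->
  \forall t' \near t, forall j, j \in J -> P j t'.
Proof.
move=> PJ; have : nbhs t (\bigcap_(j in [set` J]) [set t' | P j t']).
  exact: filter_bigI.
by apply: filterS => t' Pt' j jJ; exact: Pt'.
Qed.

Lemma near_sum_gt (J : {fset I}) (t : T) c : c < \sum_(j <- J) a j t ->
  \forall t' \near t, c < \sum_(j <- J) a j t'.
Proof. exact: (cvgr_gt _ (@continuous_sum _ _ _ J _ ca t)). Qed.

(** A finite set J witnessing that i is light at t consists of finitely many
    strict inequalities between continuous functions. *)
Lemma near_light (t : T) i : ~ heavy t i -> \forall t' \near t, ~ heavy t' i.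
Proof.
move=> /lightP[J [aJ eJ]]; near=> t'; move=> /(_ J) h.
have : \sum_(j <- J) a j t' <= 1 - e.
  apply: h; near: t'; apply: near_fset => j /aJ aij.
  have cB : (a j t' - a i t') @[t' --> t] --> a j t - a i t.
    by apply: cvgB; exact: ca.
  have : 0 < a j t - a i t by rewrite subr_gt0.
  by move=> /(cvgr_gt _ cB); apply: filterS => t'; rewrite subr_gt0.
by apply/negP; rewrite -ltNge; near: t'; exact: near_sum_gt.
Unshelve. all: by end_near. Qed.

(** Choose a finite J0' carrying more than 1 - e, all of whose masses exceed
    some m > 0 at t, and a finite J1 carrying more than 1 - m.  Both facts
    persist near t, where every index outside J1 has mass less than m and is
    therefore light, as J0' witnesses. *)
Lemma heavy_locally_finite (t : T) :
  exists J : {fset I}, \forall t' \near t, heavy t' `<=` [set` J].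
Proof.
have [J0 eJ0] := a_sum1 t e_gt0.
(* Indices of zero mass are discarded, so that a positive m below all the
   masses of J0' exists. *)
pose J0' := [fset j in J0 | 0 < a j t]%fset.
have eJ0' : 1 - e < \sum_(j <- J0') a j t.
  rewrite (@big_fset_incl _ _ _ _ J0' J0)//; first exact: fset_sub.
  by move=> j jJ0; rewrite !inE jJ0/= -leNgt => aj0; apply/le_anti/andP.
have [m [m_gt0 mJ0']] : exists m, 0 < m /\ forall j, j \in J0' -> m < a j t.
  apply: (@filter_ex _ (0:R)^'+); apply: filterI; first exact: nbhs_right_gt.
  have : (0:R)^'+ (\bigcap_(j in [set` J0']) [set m | m < a j t]).
    apply: filter_bigI => j; rewrite !inE => /andP[_ aj0].
    exact: nbhs_right_lt.
  by apply: filterS => m mP j jJ; exact: mP.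
have near_m : \forall t' \near t, forall j, j \in J0' -> m < a j t'.
  apply: near_fset => j jJ0'.
  exact: (cvgr_gt _ (@ca j t) _ (mJ0' j jJ0')).
have [J1 mJ1] := a_sum1 t m_gt0.
exists J1; near=> t' => i hi; apply: contrapT => /negP iJ1.
have ai_lt : a i t' < m.
  have /(le_lt_trans (a_le1 (i |` J1)%fset t')) : 1 < m + \sum_(j <- J1) a j t'.
    by rewrite -ltrBlDl; near: t'; exact: near_sum_gt.
  by rewrite big_fsetU1//= ltrD2r.
have : \sum_(j <- J0') a j t' <= 1 - e.
  apply: hi => j jJ0'; apply: lt_trans ai_lt _; exact: (near near_m t').
by apply/negP; rewrite -ltNge; near: t'; exact: near_sum_gt.
Unshelve. all: by end_near. Qed.

(** Let i have the largest mass in F.  A set J witnessing that i is light is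
    disjoint from F and carries more than 1 - e, which leaves less than e
    for F. *)
Lemma light_sum_lt (F : {fset I}) t : (forall i, i \in F -> ~ heavy t i) ->
  \sum_(i <- F) a i t < e.
Proof.
have [->|[i0 i0F]] := fset_0Vmem F; first by rewrite big_seq_fset0.
move=> lF.
have [i _ maxi] := @Order.TotalTheory.arg_maxP _ _ _ [` i0F]%fset xpredT
  (fun i : F => a (val i) t) erefl.
have [J [aJ eJ]] := lightP (lF _ (fsvalP i)).
have FJ : [disjoint F & J]%fset.
  apply/fdisjointP => j jF; apply/negP => /aJ.
  by apply/negP; rewrite -leNgt; exact: (maxi [` jF]%fset).
have := a_le1 (F `|` J)%fset t; rewrite sum_fsetU_disjoint//; lra.
Qed.

(** Near t the heavy indices lie in a fixed finite set, and each of its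
    finitely many members that is light at t stays light. *)
Lemma heavy_selection : exists S : T -> {fset I}, forall t : T,
  1 - e <= \sum_(i <- S t) a i t /\ \forall t' \near t, (S t' `<=` S t)%fset.
Proof.
have fin_heavy t : finite_set (heavy t).
  have [J /nbhs_singleton hJ] := heavy_locally_finite (t : T).
  exact: sub_finite_set hJ _.
exists (fun t => fset_set (heavy t)) => t; split.
  apply/ler_addgt0Pr => d d0; have [J dJ] := a_sum1 t d0.
  have := big_fsetID +%R (mem (fset_set (heavy t))) J (a ^~ t) => /= JE.
  have lJ :
      \sum_(i <- [fset x in J | x \notin fset_set (heavy t)]%fset) a i t < e.
    apply: light_sum_lt => i; rewrite !inE /= => /andP[_].
    by rewrite in_fset_set// => /negP hi /mem_set.
  have hJ : \sum_(i <- [fset x in J | x \in fset_set (heavy t)]%fset) a i t <=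
      \sum_(i <- fset_set (heavy t)) a i t.
    apply: le_sum_fset => //; apply/fsubsetP => i.
    by rewrite !inE/= => /andP[].
  lra.
have [J hJ] := heavy_locally_finite (t : T).
have light_near : \forall t' \near t,
    forall i, i \in J -> heavy t' i -> heavy t i.
  apply: near_fset => i _; have [hi|/near_light] := pselect (heavy t i).
    by near=> t'.
  by apply: filterS => t' nhi /nhi.
near=> t'; apply/fsubsetP => i; rewrite !in_fset_set// => /set_mem hi.
apply/mem_set; move: (hi).
have iJ : i \in J by apply: (near hJ t').
by move: i iJ {hi}; near: t'.
Unshelve. all: by end_near. Qed.

End heavy_indices.

(** * Radon probability measures *)

Section radon_integral.
Variables (R : realType) (X : topologicalType).
Implicit Types (x : X) (mu : radon_prob R X) (f g : X -> R).

(** The measurable space on which a Radon probability was built remembers a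
    point of X, but the measure axioms do not involve it; every mu can thus be
    read over the point x of one's choice, and all the integrals over the same
    measurable space. *)
Lemma radon_prob_borel mu x :
  exists P : probability (borel_space x) R, (mu : set X -> \bar R) = P.
Proof.
have [[y [P muP]] _ _] := radon_probP mu.
pose m : set (borel_space x) -> \bar R := mu.
have m0 : m set0 = 0%E by rewrite /m muP measure0.
have m_ge0 : (forall A, 0 <= m A)%E by move=> A; rewrite /m muP measure_ge0.
have m_sigma : semi_sigma_additive m.
  by move=> F mF tF mUF; rewrite /m muP; exact: measure_semi_sigma_additive.
pose mM := isMeasure.Build _ _ _ m m0 m_ge0 m_sigma.
pose m' := HB.pack_for {measure set (borel_space x) -> \bar R} m mM.
have m1 : m' setT = 1%E by rewrite /= /m muP probability_setT.
exists (HB.pack_for (probability (borel_space x) R) m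
  mM (Measure_isProbability.Build _ _ _ m' m1)).
by [].
Qed.

Lemma radon_prob_setT mu : mu setT = 1%E.
Proof.
by have [[x [P ->]] _ _] := radon_probP mu; exact: probability_setT.
Qed.

Lemma open_borel x (U : set X) : open U -> measurable (U : set (borel_space x)).
Proof. by move=> oU; exact: sub_sigma_algebra. Qed.

Lemma closed_borel x (C : set X) :
  closed C -> measurable (C : set (borel_space x)).
Proof.
move=> cC; rewrite -(setCK C); apply: measurableC; apply: open_borel.
by rewrite openC.
Qed.

Lemma continuous_borel x g : continuous g ->
  measurable_fun [set: borel_space x] (g : borel_space x -> R).
Proof.
move=> /continuousP cg; apply: (measurability _ (RGenOpens.measurableE R)).
move=> _ [_ [a [b ->] <-]]; rewrite setTI; apply: open_borel.
exact/cg/interval_open.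
Qed.

Lemma bounded_fun01 g : (forall y, 0 <= g y <= 1) -> bounded_fun g.
Proof.
move=> g01; exists 1; split=> // M M1 y _ /=; have /andP[? ?] := g01 y.
by rewrite ger0_norm// (le_trans _ (ltW M1)).
Qed.

Lemma integrable_continuous x (P : probability (borel_space x) R) g :
  continuous g -> bounded_fun g ->
  P.-integrable setT (EFin \o (g : borel_space x -> R)).
Proof.
move=> cg bg; apply: measurable_bounded_integrable => //.
  by rewrite (le_lt_trans (probability_le1 P _)) ?ltry.
exact: continuous_borel.
Qed.

Lemma borel_integral_sum (I : Type) (J : seq I) (p : I -> X -> R) x mu :
  (forall i, continuous (p i)) -> (forall i, bounded_fun (p i)) ->
  borel_integral x (fun y => \sum_(i <- J) p i y) mu =
  \sum_(i <- J) borel_integral x (p i) mu.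
Proof.
move=> cp bp; have [P muP] := radon_prob_borel mu x.
rewrite /borel_integral muP.
have intp i := integrable_continuous P (cp i) (@bp i).
under eq_integral do rewrite -sumEFin.
rewrite integral_sum // sum_fine // => i _.
exact: integrable_fin_num (intp i).
Qed.

Lemma borel_integral_le x g mu (A : set X) : closed A -> continuous g ->
  (forall y, 0 <= g y <= 1) -> (forall y, ~ A y -> g y = 0) ->
  ((borel_integral x g mu)%:E <= mu A)%E.
Proof.
move=> cA cg g01 gA; have [P muP] := radon_prob_borel mu x.
have mA : measurable (A : set (borel_space x)) := closed_borel cA.
have bg : bounded_fun g := bounded_fun01 g01.
rewrite /borel_integral muP fineK; last first.
  exact: integrable_fin_num (integrable_continuous P cg bg).
have -> : P A = (\int[P]_y (\1_(A : set (borel_space x)) y)%:E)%E.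
  by rewrite integral_indic// setIT.
apply: ge0_le_integral => //.
- by move=> y _; rewrite lee_fin; case/andP: (g01 y).
- by apply/measurable_EFinP; exact: continuous_borel.
- by apply/measurable_EFinP; exact: measurable_indic.
move=> y _; rewrite lee_fin indicE; have [yA|/negP yA] := boolP (y \in A).
  by case/andP: (g01 y).
by rewrite gA// => Ay; apply: yA; exact: mem_set.
Qed.

Lemma borel_integral_ge x g mu (A : set X) : closed A -> continuous g ->
  (forall y, 0 <= g y <= 1) -> (forall y, A y -> g y = 1) ->
  (mu A <= (borel_integral x g mu)%:E)%E.
Proof.
move=> cA cg g01 gA; have [P muP] := radon_prob_borel mu x.
have mA : measurable (A : set (borel_space x)) := closed_borel cA.
have bg : bounded_fun g := bounded_fun01 g01.
rewrite /borel_integral muP fineK; last first.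
  exact: integrable_fin_num (integrable_continuous P cg bg).
have -> : P A = (\int[P]_y (\1_(A : set (borel_space x)) y)%:E)%E.
  by rewrite integral_indic// setIT.
apply: ge0_le_integral => //.
- by apply/measurable_EFinP; exact: measurable_indic.
- by apply/measurable_EFinP; exact: continuous_borel.
move=> y _; rewrite lee_fin indicE; have [yA|/negP yA] := boolP (y \in A).
  by rewrite gA//; exact: set_mem yA.
by case/andP: (g01 y).
Qed.

(** For each admissible pair (x, g) this is one of the initial topologies whose
    supremum is the weak topology. *)
Lemma continuous_borel_integral x g : continuous g -> bounded_fun g ->
  continuous (borel_integral x g : radon_prob R X -> R).
Proof.
move=> cg bg mu.
pose i : X * bounded_continuous R X := (x, exist _ g (conj cg bg)).
have /cvg_sup/(_ i) mu_i : nbhs mu --> mu by exact: cvg_id.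
apply: cvg_trans (@initial_continuous _ _
  (borel_integral x g : radon_prob R X -> R) mu).
by move=> A /= /mu_i.
Qed.

Lemma radon_compact (mu : radon_prob R X) (d : R) : 0 < d ->
  exists2 K, compact K & ((1 - d)%:E < mu K)%E.
Proof.
move=> d0; have [_ radon_mu _] := radon_probP mu.
have : ((1 - d)%:E < mu setT)%E.
  by rewrite radon_prob_setT lte_fin ltrBlDr ltrDl.
have mT : <<s @open X >> setT by apply: sub_sigma_algebra; exact: openT.
rewrite {1}(radon_mu _ mT) => /ereal_sup_gt[_ [K [_ cK] <-]] dK.
by exists K.
Qed.

Lemma radon_prob_bigcapC mu (F : nat -> set X) (e : R) : 0 <= e ->
    (forall n, closed (F n)) ->
    (forall n, (mu (~` F n) <= (e / (2 ^ n.+1)%:R)%:E)%E) ->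
  (mu (~` \bigcap_n F n) <= e%:E)%E.
Proof.
move=> e0 clF muF; have [[x _] _ _] := radon_probP mu.
have [P muP] := radon_prob_borel mu x.
have mFC n : measurable (~` F n : set (borel_space x)).
  by apply: open_borel; exact: closed_openC.
have mC : measurable (~` \bigcap_n F n : set (borel_space x)).
  by apply: open_borel; apply: closed_openC; exact: closed_bigI.
apply: le_trans (epsilon_trick0 xpredT e0).
rewrite muP.
apply: (le_trans (measure_sigma_subadditive P mFC mC _)).
  by rewrite setC_bigcap.
apply: lee_nneseries => n *; first exact: measure_ge0.
by have := muF n; rewrite muP.
Qed.

End radon_integral.

(** * Complete sequences of covers *)

(** Closures, because the supports of a partition of unity subordinate to C are
    only contained in closures of members of C. *)
Definition finitely_covered (X : topologicalType) (C : set (set X))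
    (A : set X) :=
  exists D : set (set X),
    [/\ finite_set D, D `<=` C & A `<=` \bigcup_(U in D) closure U].

(** The internal form of Cech-completeness, in which the compactification no
    longer appears. *)
Definition complete_covers (X : topologicalType) (C : nat -> set (set X)) :=
  forall P : set_system X, ProperFilter P ->
    (forall n, exists2 A, P A & finitely_covered (C n) A) -> cluster P !=set0.

(** The image of such a filter clusters at some y in the compactification.  For
    each n, y lies in a finite union of closures contained in G_n; thus y is in
    the range, and its preimage is a cluster point of the filter. *)
Lemma cech_complete_covers (X : topologicalType) : cech_complete X ->
  exists C : nat -> set (set X),
    (forall n, open_cover (C n)) /\ complete_covers C.
Proof.
move=> [K [c [[cK hK [inj_c open_c] _] [G oG rangeG]]]].
have open_pre V : open V -> open (c @^-1` V) by rewrite open_c => oV; exists V.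
have regK : regular_space K.
  by move=> y; apply: (compact_regular hK cK); exact: filterT.
exists (fun n => [set U | open U /\ closure (c @` U) `<=` G n]); split.
  move=> n; split; first by move=> U [].
  apply/seteqP; split=> // x _.
  have Gcx : G n (c x).
    by have : range c (c x) by []; rewrite rangeG => /(_ n I).
  have [V Vcx VG] : filter_from (nbhs (c x)) closure (G n).
    by apply: regK; apply: open_nbhs_nbhs; split => //; exact: oG.
  exists (c @^-1` V°); last exact: Vcx.
  split; first by apply: open_pre; exact: open_interior.
  apply: subset_trans VG; apply: closureS => _ [z Vz <-].
  exact: interior_subset Vz.
move=> P PP Pcov.
have [y [_ yP]] := cK (c @ P) _ filterT.
have cP A : P A -> (c @ P) (c @` A).
  by move=> PA; apply: (@filterS _ P _ A) => // x Ax; exists x.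
have yG n : G n y.
  have [A PA [D [finD DC AD]]] := Pcov n.
  have clD : closed (\bigcup_(U in D) closure (c @` U)).
    by apply: closed_bigcup => // U _; exact: closed_closure.
  have : (\bigcup_(U in D) closure (c @` U)) y.
    apply: clD => B By.
    have [_ [[x Ax <-] Bcx]] := yP (c @` A) B (cP _ PA) By.
    exists (c x); split => //.
    have [U DU clUx] := AD _ Ax; exists U => // W Wcx.
    have [|z [Uz Wz]] := clUx (c @^-1` W°).
      by apply: open_nbhs_nbhs; split; [apply: open_pre; exact: open_interior|].
    by exists (c z); split; [exists z|exact: interior_subset Wz].
  by move=> [U DU Uy]; have [_] := DC _ DU; apply.
have [x _ cx] : range c y by rewrite rangeG.
exists x => A B PA; rewrite nbhsE => -[B' [+ B'x] B'B].
rewrite open_c => -[V oV VB'].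
have [|_ [[z Az <-] Vz]] := yP (c @` A) V (cP _ PA).
  by apply: open_nbhs_nbhs; split => //; rewrite -cx; move: B'x; rewrite -VB'.
by exists z; split => //; apply: B'B; rewrite -VB'.
Qed.

(** * Upper semi-continuous maps with compact values *)

Section usco_maps.
Variables (Z X : topologicalType).

(** If an open U contains the intersection at z, then it contains a finite
    intersection \bigcap_(n < N) F_n(z); otherwise these finite intersections
    minus U would generate a filter clustering in \bigcap_n F_n(z) but not in U.
    The finitely many inclusions F_n(z') `<=` F_n(z) with n < N hold for z'
    near z. *)
Lemma usco_bigcap (C : nat -> set (set X)) (F : nat -> Z -> set X) :
    complete_covers C ->
    (forall n z, closed (F n z)) ->
    (forall n z, finitely_covered (C n) (F n z)) ->
    (forall n z, \forall z' \near z, F n z' `<=` F n z) ->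
  (forall z, compact (\bigcap_n F n z)) /\ usc (fun z => \bigcap_n F n z).
Proof.
move=> cC clF Fcov nearF.
have clus z (P : set_system X) : ProperFilter P -> (forall n, P (F n z)) ->
    exists2 x, cluster P x & forall n, F n z x.
  move=> PP PF; have [|x Px] := cC P PP; first by move=> n; exists (F n z).
  exists x => // n; apply: clF => B Bx; exact: Px.
split=> [z P PP PF|U oU].
  have [|x Px Fx] := clus z P PP.
    by move=> n; apply: filterS PF => x; exact.
  by exists x; split => // n _.
rewrite openE => z /= FU; rewrite /interior.
pose B N := (\bigcap_(n in `I_N) F n z) `\` U.
have [[N BN]|nB] := pselect (exists N, B N = set0).
  have : nbhs z (\bigcap_(n in [set` [fset n in iota 0 N]%fset])
      [set z' | F n z' `<=` F n z]).
    by apply: filter_bigI => n _; exact: nearF.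
  apply: filterS => z' Fz' x Fx; apply: contrapT => nUx.
  suff : B N x by rewrite BN.
  split=> // n nN; apply: (Fz' n) => //; last exact: Fx.
  by rewrite /= inE mem_iota.
have PP : ProperFilter (filter_from setT B).
  apply: filter_from_proper.
    apply: filter_from_filter; first by exists 0%N.
    move=> M N _ _; exists (maxn M N) => // x [Bx nUx].
    by split; split => // n nn; apply: Bx; rewrite /= leq_max; apply/orP;
      [left|right].
  by move=> N _; apply/set0P/negP => /eqP BN; apply: nB; exists N.
have [|x Px Fx] := clus z _ PP.
  by move=> n; exists n.+1 => // x [Bx _]; apply: Bx => /=.
have Ux : U x by apply: FU => n _.
have [||y [[_ nUy] Uy]] := Px (B 0%N) U.
- by exists 0%N.
- by apply: open_nbhs_nbhs.
by [].
Qed.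

(** Each point of K has a neighbourhood disjoint from a member of P, and
    compactness makes the member uniform. *)
Lemma cluster_compact_avoid (K : set X) (P : set_system X) :
    compact K -> ProperFilter P -> K `&` cluster P = set0 ->
  exists V A, [/\ open V, K `<=` V, P A & V `&` A = set0].
Proof.
move=> /compact_near_coveringP cK PP KP0.
have avoid_near x : K x -> \forall x' \near x & A \near powerset_filter_from P,
    nbhs x' (~` A).
  move=> Kx; have /existsNP[A /existsNP[B]] : ~ cluster P x.
    by move=> Px; have : (K `&` cluster P) x by []; rewrite KP0.
  move=> /not_implyP[PA /not_implyP[Bx AB0]].
  exists (B°, [set A' | P A' /\ A' `<=` A]).
    by split; [exact: nbhs_interior|exact: powerset_filter_fromP].
  move=> [x' A'] /= [Bx' [_ A'A]]; apply: filterS Bx' => y By A'y.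
  by apply: AB0; exists y; split; [exact: A'A|].
have near_A := cK _ _ _ (powerset_filter_from_filter PP) avoid_near.
have [A [PA KA]] := filter_ex (filterI (near_small_set PP) near_A).
exists (~` A)°, A; split => //; first exact: open_interior.
apply/disjoints_subset; exact: interior_subset.
Qed.

(** A filter P on the union is transferred to the filter Q on T generated by the
    sets of z for which psi z meets a given member of P.  If Q clusters at z,
    then P clusters in psi z: otherwise an open set around psi z would avoid a
    member A of P, and upper semi-continuity would keep psi z' away from A for z' near z. *)
Lemma usc_compact_bigcup (psi : Z -> set X) (T : set Z) :
    usc psi -> (forall z, compact (psi z)) -> compact T ->
  compact (\bigcup_(z in T) psi z).
Proof.
move=> uscpsi cpsi cT P PP PT.
pose Q : set_system Z := [set B | exists2 A, P A &
  forall z, T z -> psi z `&` A !=set0 -> B z].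
have QP : ProperFilter Q.
  split.
    move=> [A PA nA]; have [x [[z Tz px] Ax]] := filter_ex (filterI PT PA).
    by apply: (nA z) => //; exists x.
  split.
  - by exists setT => //; exact: filterT.
  - move=> B B' [A PA AB] [A' PA' AB']; exists (A `&` A'); first exact: filterI.
    move=> z Tz [x [px [Ax A'x]]].
    by split; [apply: AB|apply: AB'] => //; exists x.
  - by move=> B B' BB' [A PA AB]; exists A => // z Tz pA; apply/BB'/AB.
have [z [Tz Qz]] : T `&` cluster Q !=set0.
  by apply: cT => //; exists setT => //; exact: filterT.
apply: contrapT => nclus.
have [V [A [oV pV PA VA0]]] :
    exists V A, [/\ open V, psi z `<=` V, P A & V `&` A = set0].
  apply: cluster_compact_avoid => //.
  apply/seteqP; split=> // x [px Px]; apply: nclus.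
  by exists x; split => //; exists z.
have [||z' [[_ [x [px Ax]]] pV']] := Qz
  [set z' | T z' /\ psi z' `&` A !=set0] [set z' | psi z' `<=` V].
- by exists A.
- by apply: open_nbhs_nbhs; split => //; exact: uscpsi.
have : (V `&` A) x by split => //; exact: pV'.
by rewrite VA0.
Qed.

End usco_maps.

(** Under the hypothesis, preimages of subbasic open sets are subbasic, and a
    neighbourhood contains a finite intersection of subbasic open sets. *)
Lemma upper_vietoris_continuous (Y Z : topologicalType)
    (Phi : compacts Z -> compacts Y) :
    (forall V : set Y, open V -> exists2 W : set Z, open W &
       forall T : compacts Z, (T : set Z) `<=` W <-> (Phi T : set Y) `<=` V) ->
  continuous Phi.
Proof.
move=> PhiV T A; rewrite nbhsE => -[_ [[B sB <-] [E BE EPhiT]] BA].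
apply: (@filterS _ (nbhs T) _ (Phi @^-1` E)).
  by move=> T' ET'; apply: BA; exists E.
have [D Dopen DE] := sB _ BE.
rewrite -DE; apply: filter_bigI => V DV.
have [W oW WV] := PhiV V (set_mem (Dopen _ DV)).
pose subW := [set T' : compacts Z | (T' : set Z) `<=` W].
have open_subW : open subW.
  exists [set subW].
    move=> _ ->; exists [fset W]%fset.
      by move=> V' /fset1P ->; exact: mem_set.
    by apply/seteqP; split=> T' /=; [apply; exact: fset11|move=> ? V' /fset1P ->].
  by apply/seteqP; split=> T' /=; [move=> [_ -> //]|exists subW].
have subWE : subW = [set T' | (Phi T' : set Y) `<=` V].
  by apply/seteqP; split=> T' /WV.
rewrite subWE in open_subW.
by apply: open_nbhs_nbhs; split; [exact: open_subW|
  move: EPhiT; rewrite -DE => /(_ V DV)].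
Qed.

(** * Tight upper semi-continuous selections *)

Section tight_selection.
Variables (R : realType) (X : topologicalType).
Hypotheses (hX : hausdorff_space X) (regX : regular_space X).
Hypothesis pX : paracompact X.

(** Finite sums increase with the index set and never exceed 1, so the value 1
    is eventually reached along the directed set of finite index sets, locally
    and hence uniformly on K. *)
Lemma partition_of_unity_compact (I : choiceType) (p : I -> X -> R)
    (K : set X) :
  partition_of_unity p -> compact K ->
  exists J : {fset I}, forall x, K x -> \sum_(i <- J) p i x = 1.
Proof.
move=> [cp p_ge0 p_le1 p1].
have sum_mono (J J' : {fset I}) x : (J `<=` J')%fset ->
    \sum_(i <- J) p i x = 1 -> \sum_(i <- J') p i x = 1.
  move=> JJ' J1; apply/le_anti; rewrite p_le1/= -J1.
  exact: le_sum_fset.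
pose larger := filter_from setT
  (fun J : {fset I} => [set J' : {fset I} | (J `<=` J')%fset]).
have larger_filter : Filter larger.
  apply: filter_from_filter; first by exists fset0.
  move=> J J' _ _; exists (J `|` J')%fset => // J'' /=.
  by rewrite fsubUset => /andP.
move=> /compact_near_coveringP/(_ _ larger
  (fun J x => \sum_(i <- J) p i x = 1) larger_filter)[x Kx|J _ JK].
  have [J Jx] := p1 x.
  exists ([set y | \sum_(i <- J) p i y = 1], [set J' | (J `<=` J')%fset]).
    by split => //; exists J.
  by move=> [y J'] [/= yJ JJ']; exact: sum_mono JJ' yJ.
by exists J => x Kx; apply: JK => //=.
Qed.

(** The masses \int p_V dmu of a partition of unity subordinate to C satisfy the
    hypotheses of [heavy_selection]: they sum to 1 because compact sets carry
    almost all of mu.  The integral of the sum of the heavy p_V, which is at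
    least 1 - e, is a lower bound for mu of the union F(mu) of their closed
    supports. *)
Lemma tight_selection (C : set (set X)) (e : R) : 0 < e -> open_cover C ->
  exists F : radon_prob R X -> set X, forall mu,
    [/\ closed (F mu), finitely_covered C (F mu),
        (mu (~` F mu) <= e%:E)%E & \forall nu \near mu, F nu `<=` F mu].
Proof.
move=> e0 ocC.
(* Integrals are taken over the measurable space built from a point x0; when X
   is empty there is no measure and nothing to prove. *)
have [[x0 _]|nX] := pselect ([set: X] !=set0); last first.
  exists (fun=> set0) => mu; have [[x _] _ _] := radon_probP mu.
  by exfalso; apply: nX; exists x.
have [p [pU pC]] := paracompact_partition_of_unity R regX pX ocC.
have [cp p_ge0 p_le1 p1] := pU.
pose a V (mu : radon_prob R X) := borel_integral x0 (p V) mu.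
have p01 V x : 0 <= p V x <= 1.
  by rewrite p_ge0 -(big_seq_fset1 +%R V (p ^~ x)) p_le1.
have bp V : bounded_fun (p V) := bounded_fun01 (p01 V).
have s01 (J : {fset set X}) x : 0 <= \sum_(V <- J) p V x <= 1.
  by rewrite p_le1 sumr_ge0.
have a_sum (J : {fset set X}) mu : \sum_(V <- J) a V mu =
    borel_integral x0 (fun y => \sum_(V <- J) p V y) mu.
  by rewrite borel_integral_sum.
have ca V : continuous (a V) by exact: continuous_borel_integral.
have [S SP] : exists S : radon_prob R X -> {fset set X}, forall mu,
    1 - e <= \sum_(V <- S mu) a V mu /\
    \forall nu \near mu, (S nu `<=` S mu)%fset.
  apply: heavy_selection => //.
  - move=> V mu; have [P muP] := radon_prob_borel mu x0.
    by rewrite /a /borel_integral muP fine_ge0// integral_ge0// => y _;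
      rewrite lee_fin.
  - move=> J mu; rewrite a_sum -lee_fin -(radon_prob_setT mu).
    apply: borel_integral_le => //; first exact: continuous_sum.
    by move=> y /(_ I).
  - move=> mu d d0; have [K cK dK] := radon_compact mu d0.
    have [J J1] := partition_of_unity_compact pU cK.
    exists J; rewrite a_sum -lte_fin; apply: lt_le_trans dK _.
    apply: borel_integral_ge => //; first exact: compact_closed.
    exact: continuous_sum.
pose supp V := closure [set y | p V y != 0].
pose F mu := \bigcup_(V in [set` S mu]) supp V.
have clF mu : closed (F mu).
  by apply: closed_bigcup => // V _; exact: closed_closure.
exists F => mu; have [Smu nearS] := SP mu; split => //.
(* Functions p_V that vanish identically have empty support and need not lie
   over any member of C, hence the restriction to S'. *)
- have /choice[U UP] V : exists U, (exists x, p V x != 0) ->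
      C U /\ [set y | p V y != 0] `<=` U.
    have [[x /pC[U CU VU]]|nV] := pselect (exists x, p V x != 0).
      by exists U.
    by exists set0.
  pose S' := [set V | V \in S mu /\ exists x, p V x != 0].
  exists (U @` S'); split.
  + apply: finite_image; apply: sub_finite_set (finite_fset (S mu)).
    by move=> V [].
  + by move=> _ [V [_ /UP[CU _]] <-].
  + move=> y [V SV clVy]; have [z [Vz _]] := clVy _ filterT.
    have [CU VU] := UP V (ex_intro _ z Vz).
    exists (U V); last exact: (closureS VU).
    by exists V => //; split => //; exists z.
- have [P muP] := radon_prob_borel mu x0.
  have mF : measurable (F mu : set (borel_space x0)) by exact: closed_borel.
  have : ((1 - e)%:E <= mu (F mu))%E.
    apply: le_trans (_ : ((\sum_(V <- S mu) a V mu)%:E <= _)%E).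
      by rewrite lee_fin.
    rewrite a_sum; apply: borel_integral_le => //; first exact: continuous_sum.
    move=> y nFy; rewrite big_seq big1// => V SV; apply: contrapT => /eqP pVy.
    by apply: nFy; exists V => //; exact: subset_closure.
  rewrite muP.
  have -> : P (~` F mu) = (1 - P (F mu))%E by exact: probability_setC.
  have /fineK <- : P (F mu) \is a fin_num by exact: fin_num_measure.
  by rewrite -EFinB !lee_fin; lra.
- apply: filterS nearS => nu /fsubsetP Snu y [V SV Vy].
  by exists V => //; exact: Snu.
Qed.

End tight_selection.

Theorem corollary3p2 (R : realType) (X : topologicalType) (eps : R)
    (crX : completely_regular_space X) (hX : hausdorff_space X)
    (pX : paracompact X) (ccX : cech_complete X) (eps0 : 0 < eps) :
  exists phi : radon_prob R X -> compacts X,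
    [/\ usco (fun mu => phi mu : set X),
        forall mu : radon_prob R X, (mu (~` phi mu) < eps%:E)%E &
        exists Phi : compacts (radon_prob R X) -> compacts X,
          [/\ forall T : compacts (radon_prob R X),
                (Phi T : set X) = \bigcup_(mu in (T : set (radon_prob R X))) phi mu,
              continuous Phi &
              forall (T : compacts (radon_prob R X)) (mu : radon_prob R X),
                (T : set (radon_prob R X)) mu -> (mu (~` Phi T) < eps%:E)%E]].
Proof.
have regX : regular_space X := @completely_regular_regular R X crX.
have [C [ocC cC]] := cech_complete_covers ccX.
pose e := Num.min eps 1 / 2.
have e_gt0 : 0 < e by rewrite divr_gt0// lt_min eps0 ltr01.
have e_lt : e < eps /\ e < 1.
  by rewrite /e; case: (leP eps 1) => ?; split; lra.
have en_gt0 n : 0 < e / (2 ^ n.+1)%:R by rewrite divr_gt0// ltr0n expn_gt0.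
have /choice[F FP] n := tight_selection hX regX pX (en_gt0 n) (ocC n).
have [|||cphi uphi] := usco_bigcap cC (F := F).
- by move=> n mu; have [] := FP n mu.
- by move=> n mu; have [] := FP n mu.
- by move=> n mu; have [] := FP n mu.
have mu_phi (mu : radon_prob R X) : (mu (~` \bigcap_n F n mu) <= e%:E)%E.
  apply: radon_prob_bigcapC; first exact: ltW.
  - by move=> n; have [] := FP n mu.
  - by move=> n; have [] := FP n mu.
have phi0 (mu : radon_prob R X) : \bigcap_n F n mu !=set0.
  apply/set0P/negP => /eqP F0; have := mu_phi mu; rewrite F0 setC0.
  by rewrite radon_prob_setT lee_fin leNgt (proj2 e_lt).
pose phi mu := Compacts (phi0 mu) (cphi mu).
have mu_lt (mu : radon_prob R X) : (mu (~` phi mu) < eps%:E)%E.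
  by apply: le_lt_trans (mu_phi mu) _; rewrite lte_fin (proj1 e_lt).
exists phi; split => //.
have Phi0 (T : compacts (radon_prob R X)) :
    \bigcup_(mu in (T : set (radon_prob R X))) phi mu !=set0.
  by have [mu Tmu] := compacts_nonempty T; have [x Fx] := phi0 mu; exists x, mu.
have cPhi (T : compacts (radon_prob R X)) :
    compact (\bigcup_(mu in (T : set (radon_prob R X))) phi mu).
  by apply: usc_compact_bigcup => //; exact: compacts_compact.
exists (fun T => Compacts (Phi0 T) (cPhi T)); split => //.
  apply: upper_vietoris_continuous => V oV.
  exists [set mu | phi mu `<=` V]; first exact: uphi.
  move=> T; split=> [TV x [mu Tmu]|TV mu Tmu x phix]; first exact: TV.
  by apply: TV; exists mu.
move=> T mu Tmu; apply: le_lt_trans (mu_lt mu).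
have [[x _] _ _] := radon_probP mu; have [P muP] := radon_prob_borel mu x.
rewrite muP; apply: le_measure; rewrite ?inE.
- by apply: open_borel; apply: closed_openC; exact: compact_closed hX (cPhi T).
- by apply: open_borel; apply: closed_openC; exact: compact_closed hX (cphi mu).
- by apply: subsetC => y Fy; exists mu.
Qed.
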